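(* The following statements hold: (i) $\mathcal{C}_p$ is a subspace of the space $\mathcal{C}_p(\Delta)$. (ii) $\mathcal{C}_{0p}$ is a subspace of the space $\mathcal{C}_{0p}(\Delta)$. (iii) $\mathcal{C}_{bp}$ is a subspace of the space $\mathcal{C}_{bp}(\Delta)$. (iv) $\mathcal{C}_r$ is a subspace of the space $\mathcal{C}_r(\Delta)$.
   Context: $\Omega$ is the vector space of all real double sequences $x=(x_{mn})_{m,n\ge 0}$. Terms with a negative index are taken to be $0$. The difference transform of $x\in\Omega$ is $\Delta x=((\Delta x)_{mn})$ with $(\Delta x)_{mn}=x_{mn}-x_{m,n-1}-x_{m-1,n}+x_{m-1,n-1}$. A double sequence $x$ converges in Pringsheim's sense to $l$ ($p\text{-}\lim x_{mn}=l$) if for every $\varepsilon>0$ there is $n_0$ with $|x_{mn}-l|<\varepsilon$ for all $m,n>n_0$. $\mathcal{C}_p$: double sequences convergent in Pringsheim's sense; $\mathcal{C}_{0p}$: those with $p\text{-}\lim x_{mn}=0$; $\mathcal{C}_{bp}$: those in $\mathcal{C}_p$ that are bounded; $\mathcal{C}_r$ (regularly convergent): those $x\in\mathcal{C}_p$ such that $(x_{mn})_n$ converges for every $m$ and $(x_{mn})_m$ converges for every $n$. For each such space $\lambda$, $\lambda(\Delta)=\{x\in\Omega:\Delta x\in\lambda\}$. *)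

(* Defs.v *)
From HB Require Import structures.
From mathcomp Require Import all_boot all_order all_algebra.
From mathcomp Require Import all_classical all_reals all_analysis.

Set Implicit Arguments.
Unset Strict Implicit.
Unset Printing Implicit Defensive.

Import Order.TTheory GRing.Theory Num.Theory.
Import numFieldNormedType.Exports.

Local Open Scope classical_set_scope.
Local Open Scope ring_scope.

(* The codomain is R^o so that the space of double sequences carries the
   pointwise R-module structure. *)
Definition Omega (R : realType) : lmodType R := (nat -> nat -> R^o)%type.

(* Terms with a negative index are 0. *)
Definition entry (R : realType) (x : Omega R) (i j : int) : R :=
  match i, j with
  | Posz m, Posz n => x m n
  | _, _ => 0
  end.

Definition Delta (R : realType) (x : Omega R) : Omega R :=
  fun m n : nat =>
    entry x m n - entry x m (n%:Z - 1) - entry x (m%:Z - 1) n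
    + entry x (m%:Z - 1) (n%:Z - 1).

Definition pringsheim_lim (R : realType) (x : Omega R) (l : R) : Prop :=
  forall e : R, 0 < e ->
    exists n0 : nat, forall m n : nat,
      (n0 < m)%N -> (n0 < n)%N -> `|x m n - l| < e.

Definition Cp (R : realType) : set (Omega R) :=
  [set x | exists l : R, pringsheim_lim x l].

Definition C0p (R : realType) : set (Omega R) :=
  [set x | pringsheim_lim x 0].

Definition Cbp (R : realType) : set (Omega R) :=
  [set x | Cp x /\ exists M : R, forall m n : nat, `|x m n| <= M].

Definition Cr (R : realType) : set (Omega R) :=
  [set x | [/\ Cp x,
     forall m : nat, cvgn (fun n : nat => x m n : R) &
     forall n : nat, cvgn (fun m : nat => x m n : R)]].

Definition Delta_domain (R : realType) (L : set (Omega R)) : set (Omega R) :=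
  [set x | L (Delta x)].

(* Both sets are linear subspaces of E and the first is included in the
   second; since the operations of U and V are those of E, this says that V
   is a vector space having U as a linear subspace. *)
Definition subspace_of (R : realType) (E : lmodType R) (U V : set E) : Prop :=
  [/\ submod_closed (mem U), submod_closed (mem V) & U `<=` V].

(* Main.v *)
Require Import Defs.
From HB Require Import structures.
From mathcomp Require Import all_boot all_order all_algebra.
From mathcomp Require Import all_classical all_reals all_analysis.
From mathcomp Require Import ring lra.

(** The difference transform is a polynomial in the two backward shifts of the
    index plane: if [rowshift] delays the first index by one and [colshift]
    the second, both filling the vacated border with zeros, then
    [Delta x = x - colshift x - rowshift x + rowshift (colshift x)].
    Hence every linear subspace of [Omega R] that is stable under both shifts
    is mapped into itself by [Delta], that is, lies in its own difference
    domain ([shift_stable_subspace_of_Delta_domain]); the domain is a subspace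
    because [Delta] is linear.

    It remains to see that the four spaces are subspaces stable under the
    shifts. Linearity is the usual calculus of limits and bounds. A shift
    keeps a Pringsheim limit and moves only its threshold up by one, since
    the zero border lies outside every quadrant [m, n > n0] with [n0 >= 0]; it
    does not enlarge a bound; and in one direction it renumbers the sections
    of the double sequence and adds a null one, in the other it delays every
    section by one step, so that convergence along rows and columns
    survives. *)

Set Implicit Arguments.
Unset Strict Implicit.
Unset Printing Implicit Defensive.

Import Order.TTheory GRing.Theory Num.Theory.
Import numFieldNormedType.Exports.

Local Open Scope classical_set_scope.
Local Open Scope ring_scope.

(** * Subspaces given by sets *)

Lemma submod_closed_setP (R : realType) (E : lmodType R) (U : set E) :
  submod_closed (mem U) <->
  U 0 /\ forall (a : R) (u v : E), U u -> U v -> U (a *: u + v).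
Proof.
split=> -[U0 UD]; split.
- by move: U0; rewrite inE.
- move=> a u v Uu Uv; have := UD a u v; rewrite !inE.
  by apply.
- by rewrite inE.
- by move=> a u v; rewrite !inE; apply: UD.
Qed.

(** * The difference transform in terms of shifts *)

Definition rowshift (R : realType) (x : Omega R) : Omega R :=
  fun m n => if m is m'.+1 then x m' n else 0.

Definition colshift (R : realType) (x : Omega R) : Omega R :=
  fun m n => if n is n'.+1 then x m n' else 0.

(** The mixed term is an iterated shift because [entry] vanishes as soon as one
    of the two indices is negative, as the two zero borders do. *)
Lemma DeltaE (R : realType) (x : Omega R) :
  Delta x = x - colshift x - rowshift x + rowshift (colshift x).
Proof.
apply/funext => m; apply/funext => n; rewrite /Delta.
have predZ (k : nat) : k.+1%:Z - 1 = k%:Z by rewrite -addn1 PoszD addrK.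
by case: m n => [|m] [|n]; rewrite ?predZ.
Qed.

Lemma entryZD (R : realType) (a : R) (x y : Omega R) (i j : int) :
  entry (a *: x + y) i j = a * entry x i j + entry y i j.
Proof. by case: i j => m [] n //=; rewrite mulr0 addr0. Qed.

Lemma Delta_linear (R : realType) (a : R) (x y : Omega R) :
  Delta (a *: x + y) = a *: Delta x + Delta y.
Proof.
apply/funext => m; apply/funext => n.
have -> : (a *: Delta x + Delta y) m n = a * Delta x m n + Delta y m n by [].
by rewrite /Delta !entryZD; ring.
Qed.

(** [Delta] is a linear combination of compositions of shifts, so stability
    under the two shifts is all that a space needs besides linearity. *)
Lemma shift_stable_subspace_of_Delta_domain (R : realType)
    (L : set (Omega R)) :
  submod_closed (mem L) ->
  (forall x, L x -> L (rowshift x)) -> (forall x, L x -> L (colshift x)) ->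
  subspace_of L (Delta_domain L).
Proof.
move=> subL Lrow Lcol; have /submod_closed_setP[L0 LD] := subL.
have LB u v : L u -> L v -> L (u - v).
  by move=> Lu Lv; rewrite addrC -scaleN1r; apply: LD.
have LA u v : L u -> L v -> L (u + v).
  by move=> Lu Lv; rewrite -(scale1r u); apply: LD.
have LDelta x : L x -> L (Delta x).
  by move=> Lx; rewrite DeltaE; apply/LA; [apply/LB; [apply/LB|]|]; auto.
split=> //; apply/submod_closed_setP; split; first exact: LDelta.
by move=> a u v; rewrite /Delta_domain /= Delta_linear; apply: LD.
Qed.

(** * Pringsheim limits *)

Lemma pringsheim_lim0 (R : realType) : pringsheim_lim (0 : Omega R) 0.
Proof. by move=> e e0; exists 0%N => m n _ _; rewrite subrr normr0. Qed.

Lemma pringsheim_limZD (R : realType) (a : R) (x y : Omega R) (l k : R) :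
  pringsheim_lim x l -> pringsheim_lim y k ->
  pringsheim_lim (a *: x + y) (a * l + k).
Proof.
move=> xl yk e e0.
(* The added 1 keeps the denominator positive when a = 0. *)
have a1 : 0 < `|a| + 1 by rewrite ltr_wpDl.
have e1 : 0 < e / 2 / (`|a| + 1) by rewrite !divr_gt0.
have e2 : 0 < e / 2 by rewrite divr_gt0.
have [N1 xN1] := xl _ e1; have [N2 yN2] := yk _ e2.
exists (maxn N1 N2) => m n; rewrite !gtn_max => /andP[m1 m2] /andP[n1 n2].
have := xN1 _ _ m1 n1; have := yN2 _ _ m2 n2.
rewrite !fctE /GRing.scale /= (ltr_pdivlMr _ _ a1) => yb xb.
have -> : a * x m n + y m n - (a * l + k) =
  a * (x m n - l) + (y m n - k) by ring.
apply: le_lt_trans (ler_normD _ _) _; rewrite normrM.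
by have := normr_ge0 (x m n - l); nra.
Qed.

(** Raising the threshold by one makes up for the delay; row 0, where the shift
    is not an entry of [x], lies below every threshold. *)
Lemma pringsheim_lim_rowshift (R : realType) (x : Omega R) (l : R) :
  pringsheim_lim x l -> pringsheim_lim (rowshift x) l.
Proof.
move=> xl e /xl[N xN]; exists N.+1 => -[//|m] n Nm Nn /=.
by apply: xN => //; apply: ltnW.
Qed.

Lemma pringsheim_lim_colshift (R : realType) (x : Omega R) (l : R) :
  pringsheim_lim x l -> pringsheim_lim (colshift x) l.
Proof.
move=> xl e /xl[N xN]; exists N.+1 => m [//|n] Nm Nn /=.
by apply: xN => //; apply: ltnW.
Qed.

(** * The four spaces are shift-stable subspaces *)

Lemma Cp_submod_closed (R : realType) : submod_closed (mem (@Cp R)).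
Proof.
apply/submod_closed_setP; split; first by exists 0; apply: pringsheim_lim0.
move=> a x y [l xl] [k yk]; exists (a * l + k).
exact: pringsheim_limZD.
Qed.

Lemma Cp_rowshift (R : realType) (x : Omega R) : Cp x -> Cp (rowshift x).
Proof. by move=> [l xl]; exists l; apply: pringsheim_lim_rowshift. Qed.

Lemma Cp_colshift (R : realType) (x : Omega R) : Cp x -> Cp (colshift x).
Proof. by move=> [l xl]; exists l; apply: pringsheim_lim_colshift. Qed.

Lemma C0p_submod_closed (R : realType) : submod_closed (mem (@C0p R)).
Proof.
apply/submod_closed_setP; split; first exact: pringsheim_lim0.
move=> a x y x0 y0; have := pringsheim_limZD a x0 y0.
by rewrite mulr0 addr0.
Qed.

Lemma Cbp_submod_closed (R : realType) : submod_closed (mem (@Cbp R)).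
Proof.
have /submod_closed_setP[Cp0 CpD] := @Cp_submod_closed R.
apply/submod_closed_setP; split.
  by split=> //; exists 0 => m n; rewrite normr0.
move=> a x y [xp [M xM]] [yp [N yN]]; split; first exact: CpD.
exists (`|a| * M + N) => m n; apply: le_trans (ler_normD _ _) _.
by rewrite /GRing.scale /= normrM lerD // ler_wpM2l.
Qed.

Lemma Cbp_rowshift (R : realType) (x : Omega R) : Cbp x -> Cbp (rowshift x).
Proof.
move=> [xp [M xM]]; split; first exact: Cp_rowshift.
exists M => -[|m] n //=.
(* On the border one needs 0 <= M, which any entry of x provides. *)
by rewrite normr0; apply: le_trans (xM 0%N 0%N).
Qed.

Lemma Cbp_colshift (R : realType) (x : Omega R) : Cbp x -> Cbp (colshift x).
Proof.
move=> [xp [M xM]]; split; first exact: Cp_colshift.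
exists M => m [|n] //=.
by rewrite normr0; apply: le_trans (xM 0%N 0%N).
Qed.

Lemma is_cvgn_ZD (R : realType) (a : R) (u v : nat -> R) :
  cvgn u -> cvgn v -> cvgn (fun n => a * u n + v n).
Proof.
move=> cu cv; apply: (@is_cvgD _ _ _ _ _ (fun n => a * u n)) => //.
by apply: is_cvgM => //; apply: is_cvg_cst.
Qed.

Lemma is_cvgn_delay (R : realType) (c : R) (u : nat -> R) :
  cvgn u -> cvgn (fun n => if n is n'.+1 then u n' else c).
Proof.
by move=> /cvg_ex[l ul]; apply/cvg_ex; exists l; rewrite -cvg_shiftS.
Qed.

Lemma Cr_submod_closed (R : realType) : submod_closed (mem (@Cr R)).
Proof.
have /submod_closed_setP[Cp0 CpD] := @Cp_submod_closed R.
apply/submod_closed_setP; split; first by split=> // k; apply: is_cvg_cst.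
move=> a x y [xp xrow xcol] [yp yrow ycol]; split; first exact: CpD.
- by move=> m; apply: (is_cvgn_ZD (xrow m) (yrow m)).
- by move=> n; apply: (is_cvgn_ZD (xcol n) (ycol n)).
Qed.

Lemma Cr_rowshift (R : realType) (x : Omega R) : Cr x -> Cr (rowshift x).
Proof.
move=> [xp xrow xcol]; split; first exact: Cp_rowshift.
- by case=> [|m]; [apply: is_cvg_cst | apply: xrow].
- by move=> n; apply: (is_cvgn_delay (xcol n)).
Qed.

Lemma Cr_colshift (R : realType) (x : Omega R) : Cr x -> Cr (colshift x).
Proof.
move=> [xp xrow xcol]; split; first exact: Cp_colshift.
- by move=> m; apply: (is_cvgn_delay (xrow m)).
- by case=> [|n]; [apply: is_cvg_cst | apply: xcol].
Qed.

Theorem theorem2p9 (R : realType) :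
  [/\ subspace_of (@Cp R) (Delta_domain (@Cp R)),
      subspace_of (@C0p R) (Delta_domain (@C0p R)),
      subspace_of (@Cbp R) (Delta_domain (@Cbp R)) &
      subspace_of (@Cr R) (Delta_domain (@Cr R))].
Proof.
split; apply: shift_stable_subspace_of_Delta_domain.
- exact: Cp_submod_closed.
- exact: Cp_rowshift.
- exact: Cp_colshift.
- exact: C0p_submod_closed.
- by move=> x; apply: pringsheim_lim_rowshift.
- by move=> x; apply: pringsheim_lim_colshift.
- exact: Cbp_submod_closed.
- exact: Cbp_rowshift.
- exact: Cbp_colshift.
- exact: Cr_submod_closed.
- exact: Cr_rowshift.
- exact: Cr_colshift.
Qed.
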